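(* Let $\mu=\mu_1\otimes\dots\otimes\mu_d$ be a product probability measure on $\mathbb{R}^d$. For each $1\le k\le d$ let $a_k:\mathbb{R}\to(0,\infty)$ be a positive function and let $A_k$ be its primitive centered with respect to $\mu_k$ (i.e. $A_k'=a_k$ and $\int A_k\,d\mu_k=0$), with $A_k\in L^2(\mu_k)$. Let $f,g:\mathbb{R}^d\to\mathbb{R}$ be functions in $L^2(\mu)$ all of whose first and second partial derivatives are integrable with respect to $\mu$. Assume that for each pair $1\le i,j\le d$, the signs of $$\partial_j\left(\frac{\partial_i f(x)}{a_i(x_i)}\right)\quad\text{and}\quad \partial_j\left(\frac{\partial_i g(x)}{a_i(x_i)}\right)$$ are constant on $\mathbb{R}^d$ and equal. Then $$\mathrm{Cov}_\mu(f,g)\ \ge\ \sum_{i=1}^d\frac{1}{\mathrm{Var}_{\mu_i}(A_i)}\,\mathrm{Cov}_\mu(f(x),A_i(x_i))\,\mathrm{Cov}_\mu(g(x),A_i(x_i)).$$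
   Context: $\mathrm{Cov}_\mu(f,g)=\int (f-\int f\,d\mu)(g-\int g\,d\mu)\,d\mu$ and $\mathrm{Var}_\mu(f)=\mathrm{Cov}_\mu(f,f)$. ''The signs of $u$ and $v$ are constant and equal'' means: either $u\ge0$ and $v\ge0$ everywhere, or $u\le0$ and $v\le0$ everywhere; the common sign may depend on the pair $(i,j)$. Standing convention: all functions have enough integrability and regularity for all written quantities (derivatives, covariances, quotients, so in particular $\mathrm{Var}_{\mu_i}(A_i)>0$) to be well defined. *)

(* Defs.v *)
From HB Require Import structures.
From mathcomp Require Import all_boot all_order all_algebra.
From mathcomp Require Import all_classical all_reals all_analysis.
Set Implicit Arguments.
Unset Strict Implicit.
Unset Printing Implicit Defensive.
Import Order.TTheory GRing.Theory Num.Theory.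
Import numFieldNormedType.Exports.
Local Open Scope classical_set_scope.
Local Open Scope ring_scope.

(* R^n is represented by n.-tuple R, which carries the product of the Borel
   sigma-algebras of its factors. *)

Section product_probability.
Context {R : realType}.

Definition tuple_cons n (p : measurableTypeR R * n.-tuple (measurableTypeR R)) :
  n.+1.-tuple (measurableTypeR R) := [tuple of p.1 :: p.2].

Lemma measurable_tuple_cons n : measurable_fun setT (@tuple_cons n).
Proof. exact: measurable_cons. Qed.

HB.instance Definition _ n := isMeasurableFun.Build _ _ _ _ (@tuple_cons n)
  (@measurable_tuple_cons n).

(* P_0 (x) ... (x) P_(n-1): the image of P_0 (x) (P_1 (x) ... (x) P_(n-1))
   under R * R^(n-1) ~ R^n. *)
Fixpoint product_probability n :
    ('I_n -> probability (measurableTypeR R) R) ->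
    probability (n.-tuple (measurableTypeR R)) R :=
  match n with
  | 0 => fun=> dirac [tuple]
  | m.+1 => fun P => distribution
      (P ord0 \x product_probability (fun i => P (lift ord0 i)))%E
      (@tuple_cons m)
  end.

Lemma product_probability_box n (P : 'I_n -> probability (measurableTypeR R) R)
    (B : 'I_n -> set (measurableTypeR R)) : (forall i, measurable (B i)) ->
  product_probability P [set x | forall i, B i (tnth x i)] =
  (\prod_(i < n) P i (B i))%E.
Proof.
elim: n P B => [|n IHn] P B mB.
  by rewrite big_ord0 /= diracE mem_set// => -[].
pose B' := [set x : n.-tuple (measurableTypeR R) |
  forall i, B (lift ord0 i) (tnth x i)].
have mB' : measurable B'.
  rewrite (_ : B' = \big[setI/setT]_(i < n)
     ((fun x => tnth x i) @^-1` B (lift ord0 i))).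
    apply: bigsetI_measurable => i _; rewrite -[X in measurable X]setTI.
    exact: measurable_tnth.
  rewrite -bigcap_seq; apply/seteqP; split=> x /= Bx i; first by move=> _.
  by apply: Bx; rewrite /= mem_index_enum.
rewrite big_ord_recl -IHn//= -[RHS]product_measure1E//=.
rewrite /distribution /pushforward; congr (product_measure1 _ _ _).
apply/seteqP; split=> -[t x] /=.
  move=> Bx; split; first exact: (Bx ord0).
  by move=> i; have := Bx (lift ord0 i); rewrite /tuple_cons tnthS.
move=> [Bt Bx] i; case: (unliftP ord0 i) => [j ->|->//].
by rewrite /tuple_cons tnthS; exact: Bx.
Qed.

End product_probability.

Section partial_derivative.
Context {R : realType} (d : nat).
Implicit Types (i : 'I_d) (f : d.-tuple R -> R) (x : d.-tuple R).

Definition set_coord i x (t : R) : d.-tuple R :=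
  [tuple if j == i then t else tnth x j | j < d].

Definition partial_derivable i f x : Prop :=
  derivable (f \o set_coord i x) (tnth x i) 1.

Definition partial i f x : R := derive1 (f \o set_coord i x) (tnth x i).

End partial_derivative.

Definition same_constant_sign {T : Type} {R : realType} (u v : T -> R) : Prop :=
  (forall x, 0 <= u x /\ 0 <= v x) \/ (forall x, u x <= 0 /\ v x <= 0).

(* Main.v *)
Require Import Defs.
From HB Require Import structures.
From mathcomp Require Import all_boot all_order all_algebra.
From mathcomp Require Import all_classical all_reals all_analysis.
From mathcomp Require Import measurable_realfun.
From mathcomp Require Import ring lra.
Set Implicit Arguments.
Unset Strict Implicit.
Unset Printing Implicit Defensive.
Import Order.TTheory GRing.Theory Num.Theory.
Import numFieldNormedType.Exports.
Local Open Scope classical_set_scope.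
Local Open Scope ring_scope.

(** Why the inequality holds.

    In dimension one, let D_f(s,t,r) be the determinant with rows (1,1,1),
    (A s, A t, A r), (f s, f t, f r). By the Cauchy-Binet (Andreief) identity,
      Var(A) Cov(f,g) - Cov(f,A) Cov(g,A)
    is one sixth of the integral of D_f D_g for the cube of the measure. That
    f'/a is monotone means that f is a convex or a concave function of A, that
    is, that D_f has a constant sign on s <= t <= r. When f and g are convex
    together or concave together, D_f D_g >= 0 everywhere, because both factors
    change sign under the same exchanges of s, t, r
    ([regression_association]).

    In higher dimension one splits off the first coordinate. With E0 and Cov0
    for the mean and the covariance in x_0 alone,
      Cov(f,g) = E[Cov0(f,g)] + Cov(E0 f, E0 g).
    In the second term E0 f and E0 g satisfy the same sign conditions in the
    remaining coordinates, and induction applies. For the first term, the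
    one-dimensional case gives Cov0(f,g) >= u v / Var(A_0), where
    u = Cov0(f,A_0) and v = Cov0(g,A_0) are functions of the remaining
    coordinates. For j > 0 the derivatives d_j d_0 f and d_j d_0 g have the same
    constant sign, which makes u and v monotone in x_j in the same direction, so
    E[u v] >= E[u] E[v] by the inequality of Harris ([harris]). Finally
    E[u] = Cov(f,A_0) and E[v] = Cov(g,A_0).

    To integrate out coordinates freely, the sign conditions are put in a form
    without derivatives: the mixed second differences of f in two distinct
    coordinates have constant sign ([mixed_sign]) and D_f has constant sign
    along each coordinate axis ([convex_sign]). These conditions pass to means
    without differentiation under the integral, but only if every section of f
    is integrable, not merely almost every one. So the induction is done for
    bounded functions ([bounded_covariance_bound]). It applies to the restriction
    of f to a cube, since a function with mixed differences of constant sign that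
    is continuous in each variable is bounded on cubes
    ([mixed_sign_clamp_bounded]). Conditioning a product measure on a cube gives
    a product measure ([product_conditioned]), and as the cube grows all the
    covariances converge by dominated convergence ([cvg_rcov_conditioned]). *)

(** * Means and covariances of bounded measurable functions *)

Section bounded_measurable.
Context {d} {T : measurableType d} {R : realType}.
Implicit Types (h k : T -> R).

(** A class of functions that are integrable for every probability measure and
    stable under products and partial means, so that integrability need not be
    carried along. *)
Definition bounded_mfun h := measurable_fun setT h /\ exists M, forall x, `|h x| <= M.

Lemma bmf_cst (c : R) : bounded_mfun (fun _ : T => c).
Proof. by split; [exact: measurable_cst|exists `|c|]. Qed.

Lemma bmfD h k : bounded_mfun h -> bounded_mfun k -> bounded_mfun (fun x => h x + k x).
Proof.
move=> [mh [M hM]] [mk [N kN]]; split; first exact: measurable_funD.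
by exists (M + N) => x; rewrite (le_trans (ler_normD _ _))// lerD.
Qed.

Lemma bmfM h k : bounded_mfun h -> bounded_mfun k -> bounded_mfun (fun x => h x * k x).
Proof.
move=> [mh [M hM]] [mk [N kN]]; split; first exact: measurable_funM.
by exists (M * N) => x; rewrite normrM ler_pM.
Qed.

Lemma bmfN h : bounded_mfun h -> bounded_mfun (fun x => - h x).
Proof.
move=> [mh [M hM]]; split; first exact: measurableT_comp.
by exists M => x; rewrite normrN.
Qed.

Lemma bmfB h k : bounded_mfun h -> bounded_mfun k -> bounded_mfun (fun x => h x - k x).
Proof. by move=> bh bk; apply: bmfD => //; exact: bmfN. Qed.

End bounded_measurable.

Lemma bmf_comp d1 d2 (T1 : measurableType d1) (T2 : measurableType d2)
    (R : realType) (h : T2 -> R) (phi : T1 -> T2) :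
  measurable_fun setT phi -> bounded_mfun h -> bounded_mfun (h \o phi).
Proof.
move=> mphi [mh [M hM]]; split; first exact: measurableT_comp.
by exists M => x; exact: hM.
Qed.

Section mean.
Context {d} {T : measurableType d} {R : realType} (P : probability T R).
Implicit Types (h k : T -> R).

Lemma bmf_integrable h : bounded_mfun h -> P.-integrable setT (EFin \o h).
Proof.
move=> [mh [M hM]]; apply: measurable_bounded_integrable => //.
  by rewrite (le_lt_trans (probability_le1 P measurableT))// ltry.
exists `|M|; split; first exact: num_real.
move=> x Mx y _; apply: le_trans (hM y) _.
by rewrite (le_trans _ (ltW Mx))// ler_norm.
Qed.

Definition mean h : R := \int[P]_x h x.

Lemma mean_cst c : mean (fun=> c) = c.
Proof. by rewrite /mean Rintegral_cst// [X in fine X]probability_setT/= mulr1. Qed.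

Lemma meanD h k : bounded_mfun h -> bounded_mfun k -> mean (fun x => h x + k x) = mean h + mean k.
Proof. by move=> bh bk; rewrite /mean RintegralD//; exact: bmf_integrable. Qed.

Lemma meanB h k : bounded_mfun h -> bounded_mfun k -> mean (fun x => h x - k x) = mean h - mean k.
Proof. by move=> bh bk; rewrite /mean RintegralB//; exact: bmf_integrable. Qed.

Lemma meanZ c h : bounded_mfun h -> mean (fun x => c * h x) = c * mean h.
Proof. by move=> bh; rewrite /mean RintegralZl//; exact: bmf_integrable. Qed.

Lemma mean_ge0 h : (forall x, 0 <= h x) -> 0 <= mean h.
Proof. by move=> h0; apply: Rintegral_ge0. Qed.

Lemma le_mean h k : bounded_mfun h -> bounded_mfun k -> (forall x, h x <= k x) -> mean h <= mean k.
Proof.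
by move=> bh bk hk; apply: le_Rintegral => //; exact: bmf_integrable.
Qed.

Lemma eq_mean h k : h =1 k -> mean h = mean k.
Proof. by move=> hk; congr mean; exact/funext. Qed.

(** Integrates in one variable the polynomials in three functions that occur in
    [chebyshev_association] and [regression_association]. *)
Lemma mean_quadratic x y z (c c1 c2 c3 c12 c13 c23 c33 : R) :
    bounded_mfun x -> bounded_mfun y -> bounded_mfun z ->
  mean (fun t => c + c1 * x t + c2 * y t + c3 * z t + c12 * (x t * y t)
                 + c13 * (x t * z t) + c23 * (y t * z t) + c33 * (z t * z t)) =
  c + c1 * mean x + c2 * mean y + c3 * mean z + c12 * mean (fun t => x t * y t)
    + c13 * mean (fun t => x t * z t) + c23 * mean (fun t => y t * z t)
    + c33 * mean (fun t => z t * z t).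
Proof.
move=> bx bY bz.
have bZ b u : bounded_mfun u -> bounded_mfun (fun t : T => b * u t) by apply: bmfM; exact: bmf_cst.
have bc : bounded_mfun (fun _ : T => c) by exact: bmf_cst.
by rewrite !meanD ?meanZ ?mean_cst//;
  do ?[exact: bmfM|exact: bmfD|apply: bZ|apply: bmfD].
Qed.

(** The real-valued covariance; see [covariance_rcov] for its relation to
    [covariance]. *)
Definition rcov h k := mean (fun x => h x * k x) - mean h * mean k.

Lemma rcovZl c h k : bounded_mfun h -> bounded_mfun k -> rcov (fun x => c * h x) k = c * rcov h k.
Proof.
move=> bh bk; rewrite /rcov meanZ// mulrBr mulrA; congr (_ - _).
rewrite -meanZ; last exact: bmfM.
by apply: eq_mean => x; rewrite mulrA.
Qed.

Lemma rcovBl h h' k : bounded_mfun h -> bounded_mfun h' -> bounded_mfun k ->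
  rcov (fun x => h x - h' x) k = rcov h k - rcov h' k.
Proof.
move=> bh bh' bk; rewrite /rcov meanB//.
have -> : mean (fun x => (h x - h' x) * k x)
    = mean (fun x => h x * k x) - mean (fun x => h' x * k x).
  by rewrite -meanB; [apply: eq_mean => x; ring|exact: bmfM..].
ring.
Qed.

End mean.

(** * Association inequalities for a single measure *)

Section mean_inequalities.
Context {d} {T : measurableType d} {R : realType} (P : probability T R).
Implicit Types (a f g h k : T -> R).

(** The double integral of (h s - h t) (k s - k t) is twice the covariance. *)
Lemma chebyshev_association h k : bounded_mfun h -> bounded_mfun k ->
  (forall s t, 0 <= (h s - h t) * (k s - k t)) -> 0 <= rcov P h k.
Proof.
move=> bh bk hk0; have bhk := bmfM bh bk.
have Ft s : mean P (fun t => (h s - h t) * (k s - k t)) =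
    h s * k s - k s * mean P h - h s * mean P k + mean P (fun t => h t * k t).
  transitivity (mean P (fun t => h s * k s + (- k s) * h t + (- h s) * k t
      + 0 * h t + 1 * (h t * k t) + 0 * (h t * h t) + 0 * (k t * h t)
      + 0 * (h t * h t))); first by apply: eq_mean => t; ring.
  by rewrite mean_quadratic//; ring.
have : 0 <= mean P (fun s => mean P (fun t => (h s - h t) * (k s - k t))).
  by do 2![apply: mean_ge0 => ?].
rewrite (_ : mean P _ = 2 * rcov P h k); first by rewrite pmulr_rge0.
transitivity (mean P (fun s => mean P (fun t => h t * k t)
    + (- mean P k) * h s + (- mean P h) * k s
    + 0 * h s + 1 * (h s * k s) + 0 * (h s * h s) + 0 * (k s * h s)
    + 0 * (h s * h s))); first by apply: eq_mean => t; rewrite Ft; ring.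
by rewrite mean_quadratic// /rcov; ring.
Qed.

(** The 3 x 3 determinant with rows (1,1,1), (a s, a t, a r), (f s, f t, f r).
    For s <= t <= r and a increasing, it is nonnegative when f is a convex
    function of a. *)
Definition convexity_det a f s t r : R :=
  (a t - a s) * (f r - f s) - (a r - a s) * (f t - f s).

(** The Andreief identity when f and g are centered and orthogonal to a: the
    matrix of the inner products of 1, a, f with 1, a, g is then diagonal. *)
Let centered_gram a f g : bounded_mfun a -> bounded_mfun f -> bounded_mfun g ->
    mean P a = 0 -> mean P f = 0 -> mean P g = 0 ->
    mean P (fun t => f t * a t) = 0 -> mean P (fun t => g t * a t) = 0 ->
  mean P (fun s => mean P (fun t => mean P (fun r =>
    convexity_det a f s t r * convexity_det a g s t r))) =
  6 * mean P (fun t => a t * a t) * mean P (fun t => f t * g t).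
Proof.
move=> ba bf bg a0 f0 g0 fa0 ga0.
set V := mean P (fun t => a t * a t); set C := mean P (fun t => f t * g t).
pose p h s t := a s * h t - a t * h s.
have Er s t : mean P (fun r => convexity_det a f s t r * convexity_det a g s t r)
    = p f s t * p g s t + (a t - a s) ^+ 2 * C + (f s - f t) * (g s - g t) * V.
  transitivity (mean P (fun r => p f s t * p g s t
      + ((a t - a s) * p g s t) * f r + ((a t - a s) * p f s t) * g r
      + ((f s - f t) * p g s t + (g s - g t) * p f s t) * a r
      + (a t - a s) ^+ 2 * (f r * g r)
      + ((a t - a s) * (g s - g t)) * (f r * a r)
      + ((a t - a s) * (f s - f t)) * (g r * a r)
      + ((f s - f t) * (g s - g t)) * (a r * a r))).
    by apply: eq_mean => r; rewrite /convexity_det /p; ring.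
  by rewrite mean_quadratic// a0 f0 g0 fa0 ga0 -/V -/C; ring.
have Et s : mean P (fun t => mean P (fun r =>
      convexity_det a f s t r * convexity_det a g s t r)) =
    2 * C * V + 2 * C * (a s * a s) + 2 * V * (f s * g s).
  transitivity (mean P (fun t => C * (a s * a s) + V * (f s * g s)
     + (- V * g s) * f t + (- V * f s) * g t + (- 2 * C * a s) * a t
     + (a s * a s + V) * (f t * g t) + (- (a s * g s)) * (f t * a t)
     + (- (a s * f s)) * (g t * a t) + (f s * g s + C) * (a t * a t))).
    by apply: eq_mean => t; rewrite Er /p; ring.
  by rewrite mean_quadratic// a0 f0 g0 fa0 ga0 -/V -/C; ring.
transitivity (mean P (fun s => 2 * C * V + 0 * f s + 0 * g s + 0 * a s
     + (2 * V) * (f s * g s) + 0 * (f s * a s) + 0 * (g s * a s)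
     + (2 * C) * (a s * a s))).
  by apply: eq_mean => s; rewrite Et; ring.
by rewrite mean_quadratic// -/V -/C; ring.
Qed.

(** Replacing f and g by the residuals of their linear regressions on a leaves
    the determinants unchanged, and the mean of the product of the residuals is
    the difference of the two sides. *)
Lemma regression_association a f g : bounded_mfun a -> bounded_mfun f -> bounded_mfun g ->
    0 < rcov P a a ->
    (forall s t r, 0 <= convexity_det a f s t r * convexity_det a g s t r) ->
  rcov P f a * rcov P g a / rcov P a a <= rcov P f g.
Proof.
move=> ba bf bg V0 fg0; set V := rcov P a a in V0 *.
pose a' x := a x - mean P a.
pose res h x := h x - mean P h - rcov P h a / V * a' x.
have ba' : bounded_mfun a' by apply: bmfB => //; exact: bmf_cst.
have bres h : bounded_mfun h -> bounded_mfun (res h).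
  move=> bh; apply: bmfB; first by apply: bmfB => //; exact: bmf_cst.
  by apply: bmfM => //; exact: bmf_cst.
have E2 h k b0 b1 b2 c0 c1 c2 : bounded_mfun h -> bounded_mfun k ->
  mean P (fun x => (b0 + b1 * h x + b2 * a x) * (c0 + c1 * k x + c2 * a x)) =
  b0 * c0 + b1 * c0 * mean P h + b0 * c1 * mean P k
  + (b0 * c2 + b2 * c0) * mean P a + b1 * c1 * mean P (fun x => h x * k x)
  + b1 * c2 * mean P (fun x => h x * a x) + b2 * c1 * mean P (fun x => k x * a x)
  + b2 * c2 * mean P (fun x => a x * a x).
  move=> bh bk; rewrite -mean_quadratic//; apply: eq_mean => x; ring.
have E1 h b0 b1 b2 : bounded_mfun h -> mean P (fun x => b0 + b1 * h x + b2 * a x) =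
    b0 + b1 * mean P h + b2 * mean P a.
  move=> bh; transitivity (mean P (fun x =>
      (b0 + b1 * h x + b2 * a x) * (1 + 0 * h x + 0 * a x))).
    by apply: eq_mean => x; ring.
  by rewrite E2//; ring.
have VE : mean P (fun x => a x * a x) = V + mean P a * mean P a.
  by rewrite /V /rcov subrK.
have covE h : mean P (fun x => h x * a x) = rcov P h a + mean P h * mean P a.
  by rewrite /rcov subrK.
(* The residuals are affine combinations, as E1 and E2 require. *)
pose c h := rcov P h a / V.
have resE h x : res h x = c h * mean P a - mean P h + 1 * h x + (- c h) * a x.
  by rewrite /res /a' /c; ring.
have a'E h x : a' x = - mean P a + 0 * h x + 1 * a x by rewrite /a'; ring.
have cV h : c h * V = rcov P h a by rewrite /c divfK// gt_eqF.
have ma' : mean P a' = 0.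
  by rewrite (eq_mean _ (a'E a)) E1//; ring.
have mres h : bounded_mfun h -> mean P (res h) = 0.
  by move=> bh; rewrite (eq_mean _ (resE h)) E1//; ring.
have mresa' h : bounded_mfun h -> mean P (fun x => res h x * a' x) = 0.
  move=> bh; under eq_mean do rewrite resE (a'E h).
  by rewrite E2// VE covE -cV; ring.
have ma'a' : mean P (fun x => a' x * a' x) = V.
  by under eq_mean do rewrite (a'E a); rewrite E2// VE; ring.
have mres2 : mean P (fun x => res f x * res g x) =
    rcov P f g - rcov P f a * rcov P g a / V.
  under eq_mean do rewrite !resE.
  by rewrite E2// VE !covE -!cV [rcov P f g]/rcov; field; rewrite gt_eqF.
have := centered_gram ba' (bres _ bf) (bres _ bg) ma' (mres _ bf) (mres _ bg)
  (mresa' _ bf) (mresa' _ bg).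
rewrite ma'a' mres2 => detE; rewrite -subr_ge0.
rewrite -(@pmulr_rge0 _ (6 * V)) ?mulr_gt0// -detE.
apply: mean_ge0 => s; apply: mean_ge0 => t; apply: mean_ge0 => r.
have detE' h : convexity_det a' (res h) s t r = convexity_det a h s t r.
  by rewrite /convexity_det /res /a'; ring.
by rewrite !detE'.
Qed.

End mean_inequalities.

(** * Integration of one coordinate in a product measure *)

Section bounded_fubini.
Context {d1 d2} {T1 : measurableType d1} {T2 : measurableType d2} {R : realType}.
Variables (P1 : probability T1 R) (P2 : probability T2 R).
Variable h : T1 * T2 -> R.
Hypothesis bh : bounded_mfun h.

Lemma bmf_section1 x : bounded_mfun (fun y => h (x, y)).
Proof. by apply: (bmf_comp _ bh); exact: measurable_pair1. Qed.

Lemma bmf_section2 y : bounded_mfun (fun x => h (x, y)).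
Proof. by apply: (bmf_comp _ bh); exact: measurable_pair2. Qed.

Let integrable_h : (P1 \x P2)%E.-integrable setT (EFin \o h).
Proof. exact: bmf_integrable. Qed.

Let EFin_mean2 x : (mean P2 (fun y => h (x, y)))%:E = (\int[P2]_y (h (x, y))%:E)%E.
Proof.
by rewrite fineK//; apply: integrable_fin_num => //; apply: bmf_integrable;
  exact: bmf_section1.
Qed.

Let EFin_mean1 y : (mean P1 (fun x => h (x, y)))%:E = (\int[P1]_x (h (x, y))%:E)%E.
Proof.
by rewrite fineK//; apply: integrable_fin_num => //; apply: bmf_integrable;
  exact: bmf_section2.
Qed.

Lemma bmf_mean2 : bounded_mfun (fun x => mean P2 (fun y => h (x, y))).
Proof.
split.
  apply/measurable_EFinP; rewrite (_ : EFin \o _ =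
    fubini_F P2 (EFin \o h)); last by apply/funext => x /=; rewrite EFin_mean2.
  exact: measurable_fubini_F integrable_h.
have [_ [M hM]] := bh; exists M => x; rewrite ler_norml.
have bs := bmf_section1 x.
rewrite -{1}(mean_cst P2 (- M)) -{2}(mean_cst P2 M).
by apply/andP; split; apply: le_mean => //; (try exact: bmf_cst) => y;
  have := hM (x, y); rewrite ler_norml => /andP[].
Qed.

Lemma bmf_mean1 : bounded_mfun (fun y => mean P1 (fun x => h (x, y))).
Proof.
split.
  apply/measurable_EFinP; rewrite (_ : EFin \o _ =
    fubini_G P1 (EFin \o h)); last by apply/funext => x /=; rewrite EFin_mean1.
  exact: measurable_fubini_G integrable_h.
have [_ [M hM]] := bh; exists M => x; rewrite ler_norml.
have bs := bmf_section2 x.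
rewrite -{1}(mean_cst P1 (- M)) -{2}(mean_cst P1 M).
by apply/andP; split; apply: le_mean => //; (try exact: bmf_cst) => y;
  have := hM (y, x); rewrite ler_norml => /andP[].
Qed.

Lemma mean_prod12 : mean (P1 \x P2)%E h =
  mean P1 (fun x => mean P2 (fun y => h (x, y))).
Proof.
rewrite /mean /Rintegral; congr fine.
rewrite -(integral12_prod_meas1 integrable_h).
by apply: eq_integral => x _; rewrite EFin_mean2.
Qed.

Lemma mean_prod21 : mean (P1 \x P2)%E h =
  mean P2 (fun y => mean P1 (fun x => h (x, y))).
Proof.
rewrite /mean /Rintegral; congr fine.
rewrite -(integral21_prod_meas1 integrable_h).
by apply: eq_integral => x _; rewrite EFin_mean1.
Qed.

End bounded_fubini.

Lemma mean_distribution d1 d2 (T1 : measurableType d1) (T2 : measurableType d2)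
    (R : realType) (P : probability T1 R) (X : {mfun T1 >-> T2}) (h : T2 -> R) :
  bounded_mfun h -> mean (distribution P X) h = mean P (h \o X).
Proof.
move=> bh; rewrite /mean /Rintegral integral_distribution//.
  by apply/measurable_EFinP; case: bh.
by apply: (@bmf_integrable _ _ _ P (h \o X)); exact: bmf_comp.
Qed.

Section product_mean.
Context {R : realType} (n : nat).
Local Notation RR := (measurableTypeR R).
Variable P : 'I_n.+1 -> probability RR R.
Variable h : n.+1.-tuple RR -> R.
Hypothesis bh : bounded_mfun h.

Definition ptail i := P (lift ord0 i).

Let bhc : bounded_mfun (h \o @tuple_cons R n).
Proof. by apply: bmf_comp bh; exact: measurable_tuple_cons. Qed.

Lemma bmf_head x : bounded_mfun (fun t : RR => h (tuple_cons (t, x))).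
Proof. exact: (bmf_section2 bhc). Qed.

Lemma bmf_tail t : bounded_mfun (fun x => h (tuple_cons (t, x))).
Proof. exact: (bmf_section1 bhc). Qed.

Lemma bmf_mean_head :
  bounded_mfun (fun x => mean (P ord0) (fun t : RR => h (tuple_cons (t, x)))).
Proof. exact: (bmf_mean1 (P ord0) (product_probability ptail) bhc). Qed.

Lemma bmf_mean_tail :
  bounded_mfun (fun t => mean (product_probability ptail)
    (fun x => h (tuple_cons (t, x)))).
Proof. exact: (bmf_mean2 (P ord0) (product_probability ptail) bhc). Qed.

Lemma mean_head_tail : mean (product_probability P) h =
  mean (P ord0) (fun t => mean (product_probability ptail)
    (fun x => h (tuple_cons (t, x)))).
Proof. by rewrite [LHS]mean_distribution// (mean_prod12 _ _ bhc). Qed.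

Lemma mean_tail_head : mean (product_probability P) h =
  mean (product_probability ptail)
    (fun x => mean (P ord0) (fun t : RR => h (tuple_cons (t, x)))).
Proof. by rewrite [LHS]mean_distribution// (mean_prod21 _ _ bhc). Qed.

End product_mean.

Section coordinates.
Context {R : realType} (n : nat).
Implicit Types (x : n.-tuple R) (s t : R).

Lemma tnth_set_coord d (x : d.-tuple R) i j t :
  tnth (set_coord i x t) j = if j == i then t else tnth x j.
Proof. by rewrite tnth_mktuple. Qed.

Lemma tnth_consS t x i : tnth (tuple_cons (t, x)) (lift ord0 i) = tnth x i.
Proof. by rewrite tnthS. Qed.

Lemma set_coord_cons0 t x s :
  set_coord ord0 (tuple_cons (t, x)) s = tuple_cons (s, x).
Proof.
apply: eq_from_tnth => i; rewrite tnth_set_coord.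
by case: (unliftP ord0 i) => [j ->|->//]; rewrite !tnth_consS.
Qed.

Lemma set_coord_consS t x i s :
  set_coord (lift ord0 i) (tuple_cons (t, x)) s = tuple_cons (t, set_coord i x s).
Proof.
apply: eq_from_tnth => j; rewrite tnth_set_coord.
case: (unliftP ord0 j) => [k ->|->//]; rewrite !tnth_consS tnth_set_coord.
by rewrite (inj_eq lift_inj).
Qed.

Lemma tuple_consP (x : n.+1.-tuple R) : exists t y, x = tuple_cons (t, y).
Proof. by case/tupleP: x => t y; exists t, y; exact/val_inj. Qed.

End coordinates.

(** * The inequality for bounded functions *)

Section total_covariance.
Context {R : realType} (n : nat).
Local Notation RR := (measurableTypeR R).
Variable P : 'I_n.+1 -> probability RR R.
Variables f g : n.+1.-tuple RR -> R.
Hypotheses (bf : bounded_mfun f) (bg : bounded_mfun g).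
Let mu := product_probability P.
Let mu' := product_probability (ptail P).

Let head (h : n.+1.-tuple RR -> R) x (t : RR) := h (tuple_cons (t, x)).
Let tail (h : n.+1.-tuple RR -> R) (t : RR) x := h (tuple_cons (t, x)).

(** The law of total covariance, conditioning on all the coordinates but the
    first. *)
Lemma total_covariance_tail : rcov mu f g =
  mean mu' (fun x => rcov (P ord0) (head f x) (head g x)) +
  rcov mu' (fun x => mean (P ord0) (head f x)) (fun x => mean (P ord0) (head g x)).
Proof.
have bF := bmf_mean_head P bf; have bG := bmf_mean_head P bg.
have bFG := bmf_mean_head P (bmfM bf bg).
rewrite [X in X + _]meanB; [|exact: bFG|exact: (bmfM bF bG)].
by rewrite /rcov !mean_tail_head//; [rewrite addrA subrK|exact: bmfM].
Qed.

Lemma total_covariance_head : rcov mu f g =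
  mean (P ord0) (fun t => rcov mu' (tail f t) (tail g t)) +
  rcov (P ord0) (fun t => mean mu' (tail f t)) (fun t => mean mu' (tail g t)).
Proof.
have bF := bmf_mean_tail P bf; have bG := bmf_mean_tail P bg.
have bFG := bmf_mean_tail P (bmfM bf bg).
rewrite [X in X + _]meanB; [|exact: bFG|exact: (bmfM bF bG)].
by rewrite /rcov !mean_head_tail//; [rewrite addrA subrK|exact: bmfM].
Qed.

End total_covariance.

Section sign_conditions.
Context {R : realType} {n : nat}.
Implicit Types (f u : n.-tuple R -> R) (x : n.-tuple R) (i j : 'I_n).

(** u is nondecreasing in coordinate i when b i is false, nonincreasing when it
    is true. *)
Definition coord_monotone (b : 'I_n -> bool) u := forall i x s t, s <= t ->
  0 <= (-1) ^+ b i * (u (set_coord i x t) - u (set_coord i x s)).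

Definition increment i s t f x := f (set_coord i x t) - f (set_coord i x s).

(** Stands for the constancy of the sign of d_j d_i f when i and j differ: a
    mixed difference is, formally, the integral of that derivative over a
    rectangle. *)
Definition mixed_sign (b : 'I_n -> 'I_n -> bool) f :=
  forall i j x s s' t t', i != j -> s <= s' -> t <= t' ->
  0 <= (-1) ^+ b i j * increment j t t' (increment i s s' f) x.

(** Stands for the constancy of the sign of d_i (d_i f / a_i), where a_i is the
    derivative of A_i. *)
Definition convex_sign (A : 'I_n -> R -> R) (b : 'I_n -> 'I_n -> bool) f :=
  forall i x s t r, s <= t -> t <= r ->
  0 <= (-1) ^+ b i i * convexity_det (A i) (fun t => f (set_coord i x t)) s t r.

End sign_conditions.

Lemma mulr_ge0_same_sign (R : realType) (b : bool) (u v : R) :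
  0 <= (-1) ^+ b * u -> 0 <= (-1) ^+ b * v -> 0 <= u * v.
Proof.
case: b; rewrite ?expr0 ?mul1r ?expr1 ?mulN1r ?oppr_ge0; first exact: mulr_le0.
exact: mulr_ge0.
Qed.

(** The product of two determinants is symmetric in s, t and r, so that only
    ordered triples matter. *)
Lemma convexity_det_same_sign (R : realType) (b : bool) (a f g : R -> R) :
    (forall s t r, s <= t -> t <= r -> 0 <= (-1) ^+ b * convexity_det a f s t r) ->
    (forall s t r, s <= t -> t <= r -> 0 <= (-1) ^+ b * convexity_det a g s t r) ->
  forall s t r, 0 <= convexity_det a f s t r * convexity_det a g s t r.
Proof.
move=> Df Dg; pose K s t r := convexity_det a f s t r * convexity_det a g s t r.
have K12 s t r : K s t r = K t s r by rewrite /K /convexity_det; ring.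
have K23 s t r : K s t r = K s r t by rewrite /K /convexity_det; ring.
have Kle s t r : s <= t -> t <= r -> 0 <= K s t r.
  by move=> st tr; apply: (mulr_ge0_same_sign (Df _ _ _ st tr) (Dg _ _ _ st tr)).
move=> s t r; rewrite -/(K s t r).
have [st|/ltW ts] := leP s t; have [tr|/ltW rt] := leP t r;
  have [sr|/ltW rs] := leP s r.
- exact: Kle.
- exact: Kle.
- by rewrite K23; exact: Kle.
- by rewrite K23 K12; exact: Kle.
- by rewrite K12; exact: Kle.
- by rewrite K12 K23; exact: Kle.
- by rewrite K12 K23 K12; exact: Kle.
- by rewrite K12 K23 K12; exact: Kle.
Qed.

Lemma rcov_same_monotone (R : realType) (P : probability (measurableTypeR R) R)
    (b : bool) (u v : R -> R) :
    bounded_mfun (u : measurableTypeR R -> R) -> bounded_mfun (v : measurableTypeR R -> R) ->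
    (forall s t, s <= t -> 0 <= (-1) ^+ b * (u t - u s)) ->
    (forall s t, s <= t -> 0 <= (-1) ^+ b * (v t - v s)) ->
  0 <= rcov P u v.
Proof.
move=> bu bv um vm; apply: chebyshev_association => // s t.
have [st|/ltW ts] := leP s t.
  by rewrite -mulrNN !opprB; exact: mulr_ge0_same_sign (um _ _ st) (vm _ _ st).
exact: mulr_ge0_same_sign (um _ _ ts) (vm _ _ ts).
Qed.

(** Induction on the number of coordinates, by the law of total covariance: the
    sections and the partial means of a coordinatewise monotone function are
    monotone in the same directions. *)
Lemma harris (R : realType) n (P : 'I_n -> probability (measurableTypeR R) R)
    (b : 'I_n -> bool) (u v : n.-tuple (measurableTypeR R) -> R) :
    bounded_mfun u -> bounded_mfun v -> coord_monotone b u -> coord_monotone b v ->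
  0 <= rcov (product_probability P) u v.
Proof.
elim: n P b u v => [|n IH] P b u v bu bv um vm.
  apply: chebyshev_association => // s t.
  by rewrite (_ : s = t) ?subrr ?mul0r//; apply: eq_from_tnth => -[].
rewrite total_covariance_head//; apply: addr_ge0.
  apply: mean_ge0 => t; apply: (IH _ (fun i => b (lift ord0 i))).
  - exact: bmf_tail.
  - exact: bmf_tail.
  - by move=> i x s s' ss'; rewrite -!set_coord_consS; exact: um.
  - by move=> i x s s' ss'; rewrite -!set_coord_consS; exact: vm.
have mean_mono h : bounded_mfun h -> coord_monotone b h -> forall s t, s <= t ->
    0 <= (-1) ^+ b ord0 *
      (mean (product_probability (ptail P)) (fun x => h (tuple_cons (t, x)))
     - mean (product_probability (ptail P)) (fun x => h (tuple_cons (s, x)))).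
  move=> bh hm s t st; rewrite -meanB; [|exact: bmf_tail..].
  rewrite -meanZ; last by apply: bmfB; exact: bmf_tail.
  by apply: mean_ge0 => x; have := hm ord0 (tuple_cons (0, x)) s t st;
    rewrite !set_coord_cons0.
apply: (@rcov_same_monotone _ _ (b ord0)); [exact: bmf_mean_tail..| |];
  exact: mean_mono.
Qed.

Section tail_conditions.
Context {R : realType} (n : nat).
Local Notation RR := (measurableTypeR R).
Variables (P0 : probability RR R) (A : 'I_n.+1 -> R -> R).
Variables (b : 'I_n.+1 -> 'I_n.+1 -> bool) (f : n.+1.-tuple RR -> R).
Hypothesis bf : bounded_mfun f.
Let F x := mean P0 (fun t : RR => f (tuple_cons (t, x))).

Lemma mixed_sign_mean_head : mixed_sign b f ->
  mixed_sign (fun i j => b (lift ord0 i) (lift ord0 j)) F.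
Proof.
move=> fm i j x s s' t t' ij ss' tt'; rewrite /increment /F.
have bh y : bounded_mfun (fun t : RR => f (tuple_cons (t, y))) by exact: bmf_head.
rewrite -!meanB//; [|exact: bmfB..].
rewrite -meanZ; last by apply: bmfB; exact: bmfB.
by apply: mean_ge0 => t0; rewrite -!set_coord_consS; apply: fm.
Qed.

Lemma convex_sign_mean_head : convex_sign A b f ->
  convex_sign (fun i => A (lift ord0 i))
    (fun i j => b (lift ord0 i) (lift ord0 j)) F.
Proof.
move=> fc i x s t r st tr; rewrite /convexity_det /F.
have bh y : bounded_mfun (fun t : RR => f (tuple_cons (t, y))) by exact: bmf_head.
have bZ c h : bounded_mfun h -> bounded_mfun (fun t : RR => c * h t).
  by apply: bmfM; exact: bmf_cst.
rewrite -!meanB//; rewrite -!meanZ; [|exact: bmfB..].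
rewrite -meanB; [|apply: bZ; exact: bmfB..].
rewrite -meanZ; last by apply: bmfB; apply: bZ; exact: bmfB.
by apply: mean_ge0 => t0; rewrite -!set_coord_consS; exact: fc.
Qed.

(** The increment of the covariance in x_j is the covariance of a with an
    increment of f, which is monotone in the first coordinate because the mixed
    differences of f have constant sign. *)
Lemma coord_monotone_rcov_head (a : R -> R) :
    bounded_mfun (a : RR -> R) -> (forall s t, s <= t -> a s <= a t) -> mixed_sign b f ->
  coord_monotone (fun j => b ord0 (lift ord0 j))
    (fun x => rcov P0 (fun t : RR => f (tuple_cons (t, x))) a).
Proof.
move=> ba am fm j x s t st.
have bh y : bounded_mfun (fun t : RR => f (tuple_cons (t, y))) by exact: bmf_head.
rewrite -rcovBl// -rcovZl//; last exact: bmfB.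
apply: (@rcov_same_monotone _ _ false) => //.
- by apply: bmfM; [exact: bmf_cst|exact: bmfB].
- move=> r r' rr'; rewrite expr0 mul1r -mulrBr.
  have := fm ord0 (lift ord0 j) (tuple_cons (0, x)) r r' s t isT rr' st.
  rewrite /increment !set_coord_consS !set_coord_cons0.
  by congr (0 <= _ * _); ring.
- by move=> r r' rr'; rewrite expr0 mul1r subr_ge0 am.
Qed.

End tail_conditions.

(** The induction on the dimension explained at the top, with [headE] and [tailE]
    reducing the covariances with the A_i to the splitting of the first
    coordinate. *)
Theorem bounded_covariance_bound (R : realType) n
    (P : 'I_n -> probability (measurableTypeR R) R)
    (A : 'I_n -> R -> R) (b : 'I_n -> 'I_n -> bool)
    (f g : n.-tuple (measurableTypeR R) -> R) :
    (forall i, bounded_mfun (A i : measurableTypeR R -> R)) ->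
    (forall i s t, s <= t -> A i s <= A i t) ->
    (forall i, 0 < rcov (P i) (A i) (A i)) ->
    bounded_mfun f -> bounded_mfun g -> mixed_sign b f -> mixed_sign b g ->
    convex_sign A b f -> convex_sign A b g ->
  \sum_(i < n) rcov (product_probability P) f (fun x => A i (tnth x i)) *
    rcov (product_probability P) g (fun x => A i (tnth x i)) /
    rcov (P i) (A i) (A i)
  <= rcov (product_probability P) f g.
Proof.
elim: n P A b f g => [|n IH] P A b f g bA Am V0 bf bg fm gm fc gc.
  by rewrite big_ord0; apply: (@harris _ _ _ (fun=> false)) => // i; case: i.
rewrite big_ord_recl [X in _ <= X]total_covariance_tail//.
set mu' := product_probability (ptail P).
have btA i : bounded_mfun (fun x : n.+1.-tuple (measurableTypeR R) => A i (tnth x i)).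
  by apply: (bmf_comp (measurable_tnth i)).
have headE h : bounded_mfun h -> rcov (product_probability P) h (fun x => A ord0 (tnth x ord0))
    = mean mu' (fun x => rcov (P ord0) (fun t => h (tuple_cons (t, x))) (A ord0)).
  move=> bh.
  rewrite [RHS]meanB; last 2 first.
  - exact: (bmf_mean_head P (bmfM bh (btA ord0))).
  - by apply: bmfM; [exact: bmf_mean_head|exact: bmf_cst].
  rewrite /rcov !mean_tail_head//; last exact: bmfM.
  under [X in _ = _ - X]eq_mean do rewrite mulrC.
  rewrite meanZ; last exact: bmf_mean_head.
  congr (_ - _); rewrite mulrC; congr (_ * _).
  exact: (mean_cst mu' (mean (P ord0) (A ord0))).
have tailE h i : bounded_mfun h ->
    rcov (product_probability P) h (fun x => A (lift ord0 i) (tnth x (lift ord0 i)))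
    = rcov mu' (fun x => mean (P ord0) (fun t => h (tuple_cons (t, x))))
        (fun x => A (lift ord0 i) (tnth x i)).
  move=> bh; rewrite /rcov !mean_tail_head//; last exact: bmfM.
  congr (_ - _ * _); apply: eq_mean => x.
    under eq_mean do rewrite tnth_consS mulrC.
    by rewrite meanZ 1?mulrC//; exact: bmf_head.
  by under eq_mean do rewrite tnth_consS; rewrite mean_cst.
apply: lerD; last first.
  under eq_bigr do rewrite !tailE//.
  apply: (IH (ptail P) (fun i => A (lift ord0 i))
    (fun i j => b (lift ord0 i) (lift ord0 j))).
  - by move=> i; exact: bA.
  - by move=> i; exact: Am.
  - by move=> i; exact: V0.
  - exact: bmf_mean_head.
  - exact: bmf_mean_head.
  - exact: mixed_sign_mean_head.
  - exact: mixed_sign_mean_head.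
  - exact: convex_sign_mean_head.
  - exact: convex_sign_mean_head.
rewrite !headE//.
pose u h (x : n.-tuple (measurableTypeR R)) :=
  rcov (P ord0) (fun t => h (tuple_cons (t, x))) (A ord0).
have bu h : bounded_mfun h -> bounded_mfun (u h).
  move=> bh; apply: bmfB.
    exact: (bmf_mean_head P (bmfM bh (btA ord0))).
  by apply: bmfM; [exact: bmf_mean_head|exact: bmf_cst].
have uu : 0 <= rcov mu' (u f) (u g).
  apply: (harris _ (bu _ bf) (bu _ bg)).
    exact: (coord_monotone_rcov_head (P ord0) bf (bA ord0) (Am ord0) fm).
  exact: (coord_monotone_rcov_head (P ord0) bg (bA ord0) (Am ord0) gm).
rewrite /rcov subr_ge0 in uu.
apply: (@le_trans _ _ (mean mu' (fun x =>
    (rcov (P ord0) (A ord0) (A ord0))^-1 * (u f x * u g x)))).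
  rewrite meanZ; last by apply: bmfM; exact: bu.
  by rewrite mulrC ler_pM2l ?invr_gt0.
apply: le_mean.
- by apply: bmfM; [exact: bmf_cst|apply: bmfM; exact: bu].
- apply: bmfB; first exact: (bmf_mean_head P (bmfM bf bg)).
  by apply: bmfM; exact: bmf_mean_head.
move=> x; rewrite mulrC; apply: regression_association => //.
- exact: bmf_head.
- exact: bmf_head.
apply: (@convexity_det_same_sign _ (b ord0 ord0)) => s t r st tr.
  have := fc ord0 (tuple_cons (0, x)) s t r st tr.
  by rewrite /convexity_det !set_coord_cons0.
have := gc ord0 (tuple_cons (0, x)) s t r st tr.
by rewrite /convexity_det !set_coord_cons0.
Qed.

(** * Restriction to a cube *)

Section clamp.
Context {R : realType} (N : R).
Hypothesis N0 : 0 <= N.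
Local Notation RR := (measurableTypeR R).

(** Composing with the projection onto [-N, N] keeps the sign conditions on the
    whole space, whereas multiplying by the indicator of a cube would not. *)
Definition clamp (t : R) : R := Num.max (- N) (Num.min N t).

Lemma clamp_homo : {homo clamp : s t / s <= t}.
Proof. by move=> s t st; rewrite /clamp le_max2// le_min2. Qed.

Lemma clamp_itv t : clamp t \in `[- N, N].
Proof.
by rewrite in_itv/= /clamp le_max lexx/= ge_max ge_min lexx/= ge0_cp.
Qed.

Lemma clamp_id t : t \in `[- N, N] -> clamp t = t.
Proof.
by rewrite in_itv/= => /andP[Nt tN]; rewrite /clamp min_r// max_r.
Qed.

Lemma measurable_clamp : measurable_fun setT (clamp : RR -> RR).
Proof.
by apply: measurable_maxr => //; apply: measurable_minr.
Qed.

Definition clamp_tuple n (x : n.-tuple R) : n.-tuple R :=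
  [tuple clamp (tnth x i) | i < n].

Lemma measurable_clamp_tuple n :
  measurable_fun setT (@clamp_tuple n : n.-tuple RR -> n.-tuple RR).
Proof.
apply/measurable_fun_tnthP => i.
rewrite (_ : _ \o _ = clamp \o (fun x : n.-tuple RR => tnth x i)).
  by apply: measurableT_comp; [exact: measurable_clamp|exact: measurable_tnth].
by apply/funext => x /=; rewrite tnth_mktuple.
Qed.

Lemma clamp_tuple_set_coord n i (x : n.-tuple R) t :
  clamp_tuple (set_coord i x t) = set_coord i (clamp_tuple x) (clamp t).
Proof.
apply: eq_from_tnth => j; rewrite !tnth_mktuple.
by case: ifP.
Qed.

Lemma clamp_tuple_cons n t (x : n.-tuple R) :
  clamp_tuple (tuple_cons (t, x)) = tuple_cons (clamp t, clamp_tuple x).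
Proof.
apply: eq_from_tnth => j; rewrite tnth_mktuple.
by case: (unliftP ord0 j) => [k ->|->//]; rewrite !tnth_consS tnth_mktuple.
Qed.

Lemma mixed_sign_clamp n (b : 'I_n -> 'I_n -> bool) f :
  mixed_sign b f -> mixed_sign b (f \o @clamp_tuple n).
Proof.
move=> fm i j x s s' t t' ij ss' tt'; rewrite /increment /=.
by rewrite !clamp_tuple_set_coord; apply: fm => //; exact: clamp_homo.
Qed.

Lemma convex_sign_clamp n A (b : 'I_n -> 'I_n -> bool) f :
  convex_sign A b f ->
  convex_sign (fun i => A i \o clamp) b (f \o @clamp_tuple n).
Proof.
move=> fc i x s t r st tr; rewrite /convexity_det /= !clamp_tuple_set_coord.
by apply: fc; exact: clamp_homo.
Qed.

Definition corner n (b : 'I_n -> bool) : n.-tuple R :=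
  [tuple if b i then N else - N | i < n].

Lemma corner_cons n (b : 'I_n.+1 -> bool) :
  corner b = tuple_cons (if b ord0 then N else - N, corner (b \o lift ord0)).
Proof.
apply: eq_from_tnth => j; rewrite tnth_mktuple.
by case: (unliftP ord0 j) => [k ->|->//]; rewrite !tnth_consS tnth_mktuple.
Qed.

(** A coordinatewise monotone function is minimal on a cube at the corner that
    its directions of monotonicity select. *)
Lemma coord_monotone_corner n (b : 'I_n -> bool) u x :
  coord_monotone b u -> u (corner b) <= u (clamp_tuple x).
Proof.
elim: n b u x => [|n IH] b u x um.
  rewrite (_ : corner b = clamp_tuple x)//.
  by apply: eq_from_tnth => -[].
have [t [y ->]] := tuple_consP x; rewrite clamp_tuple_cons corner_cons.
have ut : coord_monotone (b \o lift ord0)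
    (fun y => u (tuple_cons (clamp t, y))).
  by move=> i z s s' ss'; rewrite -!set_coord_consS; exact: um.
apply: le_trans _ (IH _ _ y ut); set c := corner _.
have /= /andP[Nt tN] := clamp_itv t.
case b0: (b ord0).
  have := um ord0 (tuple_cons (0, c)) _ _ tN.
  by rewrite b0 !set_coord_cons0 expr1 mulN1r oppr_ge0 subr_le0.
have := um ord0 (tuple_cons (0, c)) _ _ Nt.
by rewrite b0 !set_coord_cons0 expr0 mul1r subr_ge0.
Qed.

Lemma coord_monotone_corner_norm n (b : 'I_n -> bool) u x :
  coord_monotone b u ->
  `|u (clamp_tuple x)| <= `|u (corner b)| + `|u (corner (negb \o b))|.
Proof.
move=> um; have lo := coord_monotone_corner x um.
have : coord_monotone (negb \o b) (fun x => - u x).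
  move=> i y s t st; have := um i y s t st.
  by rewrite /= -opprB opprK addrC; case: (b i); rewrite ?expr0 ?expr1; lra.
move=> /(coord_monotone_corner x); rewrite lerN2 => hi.
have := ler_norm (- u (corner b)); rewrite normrN => lo'.
have hi' := ler_norm (u (corner (negb \o b))).
have := normr_ge0 (u (corner b)); have := normr_ge0 (u (corner (negb \o b))).
by rewrite ler_norml => *; apply/andP; split; lra.
Qed.

(** By induction on the dimension f (0, .) is bounded on the cube. For t fixed,
    f (t, .) - f (0, .) is coordinatewise monotone, hence bounded by its values
    at two opposite corners that do not depend on t; these values are continuous
    functions of t. *)
Lemma mixed_sign_clamp_bounded n (b : 'I_n -> 'I_n -> bool) (f : n.-tuple R -> R) :
    mixed_sign b f ->
    (forall i x, continuous (fun t => f (set_coord i x t))) ->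
  exists M, forall x, `|f (clamp_tuple x)| <= M.
Proof.
elim: n b f => [|n IH] b f fm fcont.
  exists `|f [tuple]| => x; rewrite (_ : clamp_tuple x = [tuple])//.
  by apply: eq_from_tnth => -[].
have [|i x|M0 hM0] := IH (fun i j => b (lift ord0 i) (lift ord0 j))
    (fun x => f (tuple_cons (0, x))).
- move=> i j x s s' t t' ij ss' tt'; rewrite /increment -!set_coord_consS.
  exact: fm.
- rewrite (_ : (fun t => _) =
      (fun t => f (set_coord (lift ord0 i) (tuple_cons (0, x)) t))); first exact: fcont.
  by apply/funext => t; rewrite set_coord_consS.
(* e selects one of the two opposite corners. *)
pose c e := corner (fun j => e (+) b ord0 (lift ord0 j)).
have edge e : exists M, forall t, t \in `[- N, N] ->
    `|f (tuple_cons (t, c e)) - f (tuple_cons (0, c e))| <= M.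
  pose h t := `|f (tuple_cons (t, c e)) - f (tuple_cons (0, c e))|.
  have fl : continuous (fun t => f (tuple_cons (t, c e))).
    rewrite (_ : (fun t => _) =
      (fun t => f (set_coord ord0 (tuple_cons (0, c e)) t))); first exact: fcont.
    by apply/funext => s; rewrite set_coord_cons0.
  have hcont : continuous h.
    by move=> t; apply: cvg_norm; apply: cvgB; [exact: fl|exact: cvg_cst].
  have [||m _ hm] := @EVT_max R h (- N) N.
  - by rewrite ge0_cp.
  - exact: continuous_subspaceT.
  by exists (h m).
have [M1 hM1] := edge false; have [M2 hM2] := edge true.
exists (M0 + (M1 + M2)) => x.
have [t [y ->]] := tuple_consP x; rewrite clamp_tuple_cons.
set T := clamp t; have TN : T \in `[- N, N] := clamp_itv t.
pose u y := f (tuple_cons (T, y)) - f (tuple_cons (0, y)).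
have -> : f (tuple_cons (T, clamp_tuple y)) =
  f (tuple_cons (0, clamp_tuple y)) + u (clamp_tuple y) by rewrite /u; ring.
rewrite (le_trans (ler_normD _ _))// lerD//.
have uM : `|u (c false)| + `|u (c true)| <= M1 + M2.
  by apply: lerD; [exact: hM1|exact: hM2].
apply: le_trans uM.
have um s s' : s <= s' -> coord_monotone (fun j => b ord0 (lift ord0 j))
    (fun y => f (tuple_cons (s', y)) - f (tuple_cons (s, y))).
  move=> ss' j z r r' rr'.
  have := fm ord0 (lift ord0 j) (tuple_cons (0, z)) s s' r r' isT ss' rr'.
  by rewrite /increment !set_coord_consS !set_coord_cons0.
have [T0|/ltW T0] := leP 0 T; first exact: coord_monotone_corner_norm (um _ _ T0).
have := coord_monotone_corner_norm y (um _ _ T0).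
by rewrite ![`|f (tuple_cons (0, _)) - _|]distrC.
Qed.

End clamp.

(** * From partial derivatives to finite differences *)

Section finite_differences.
Context {R : realType}.
Implicit Types (h q a A phi : R -> R).

Lemma is_derive_continuous h h' :
  (forall t, is_derive t (1 : R) h (h' t)) -> continuous h.
Proof.
by move=> dh t; apply/differentiable_continuous/derivable1_diffP; case: (dh t).
Qed.

Lemma is_derive_le h h' : (forall t, is_derive t (1 : R) h (h' t)) ->
  forall s t, s <= t -> (forall r, r \in `]s, t[ -> 0 <= h' r) -> h s <= h t.
Proof.
move=> dh s t st h0; apply: (@ger0_derive1_le_cc _ h s t) => //.
- by move=> r rst; rewrite derive1E derive_val h0.
- exact/continuous_subspaceT/(is_derive_continuous dh).
- by rewrite in_itv/= lexx.
- by rewrite in_itv/= lexx st.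
Qed.

(** With q t * A as a tangent at t, the increments of phi are at most those of
    q t * A before t and at least those after t. *)
Lemma convexity_det_ge0 A a phi q :
    (forall t, is_derive t (1 : R) A (a t)) -> (forall t, 0 < a t) ->
    (forall t, is_derive t (1 : R) phi (q t * a t)) ->
    {homo q : s t / s <= t} ->
  forall s t r, s <= t -> t <= r -> 0 <= convexity_det A phi s t r.
Proof.
move=> dA a0 dphi qm s t r st tr.
have At u v : u <= v -> A u <= A v.
  by move=> uv; apply: (is_derive_le dA) => // ? _; exact: ltW.
have dl c u : is_derive u (1 : R) (phi \- c \*: A) ((q u - c) * a u).
  by rewrite mulrBl; apply: is_deriveB.
have dl' u : is_derive u (1 : R) (- (phi \- q t \*: A)) ((q t - q u) * a u).
  by rewrite -opprB mulNr; apply: is_deriveN; exact: dl.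
have lo : phi t - phi s <= q t * (A t - A s).
  have := is_derive_le dl' st => le_st.
  suff : - (phi s - q t * A s) <= - (phi t - q t * A t) by lra.
  apply: le_st => u; rewrite in_itv/= => /andP[_ /ltW ut].
  by rewrite mulr_ge0 ?subr_ge0 ?qm// ltW.
have hi : q t * (A r - A t) <= phi r - phi t.
  have := is_derive_le (dl (q t)) tr => le_tr.
  suff : phi t - q t * A t <= phi r - q t * A r by lra.
  apply: le_tr => u; rewrite in_itv/= => /andP[/ltW tu _].
  by rewrite mulr_ge0 ?subr_ge0 ?qm// ltW.
have -> : convexity_det A phi s t r =
    (A t - A s) * (phi r - phi t - q t * (A r - A t))
  + (A r - A t) * (q t * (A t - A s) - (phi t - phi s)).
  by rewrite /convexity_det; ring.
by rewrite addr_ge0// mulr_ge0 ?subr_ge0 ?At.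
Qed.

End finite_differences.

Section partial_to_differences.
Context {R : realType} {n : nat}.
Implicit Types (i j : 'I_n) (x : n.-tuple R) (f : n.-tuple R -> R).

Lemma set_coord_same i x s t : set_coord i (set_coord i x s) t = set_coord i x t.
Proof.
by apply: eq_from_tnth => k; rewrite !tnth_set_coord; case: (k == i).
Qed.

Lemma set_coordC i j x s t : i != j ->
  set_coord i (set_coord j x s) t = set_coord j (set_coord i x t) s.
Proof.
move=> ij; apply: eq_from_tnth => k; rewrite !tnth_set_coord.
by case: eqVneq => [->|//]; rewrite (negbTE ij).
Qed.

Lemma is_derive_partial i f : (forall x, partial_derivable i f x) ->
  forall x t, is_derive t (1 : R) (fun s => f (set_coord i x s))
    (partial i f (set_coord i x t)).
Proof.
move=> df x t; have := df (set_coord i x t).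
rewrite /partial_derivable /partial tnth_set_coord eqxx.
have -> : f \o set_coord i (set_coord i x t) = (fun s => f (set_coord i x s)).
  by apply/funext => s /=; rewrite set_coord_same.
by move=> dft; apply: DeriveDef dft _; rewrite derive1E.
Qed.

(** The factor e stands for a sign, so that both monotonicities are covered. *)
Lemma partial_ge0_le (e : R) i f : (forall x, partial_derivable i f x) ->
  (forall x, 0 <= e * partial i f x) ->
  forall x s t, s <= t ->
  e * f (set_coord i x s) <= e * f (set_coord i x t).
Proof.
move=> df f0 x s t st.
have de u : is_derive u (1 : R) (e \*: (fun s => f (set_coord i x s)))
    (e * partial i f (set_coord i x u)).
  by apply: is_deriveZ; exact: is_derive_partial.
by have := is_derive_le de st; apply => r _; exact: f0.
Qed.

Variables (a A : 'I_n -> R -> R) (f : n.-tuple R -> R).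
Variable b : 'I_n -> 'I_n -> bool.
Let q i y := partial i f y / a i (tnth y i).
Hypothesis a_gt0 : forall i t, 0 < a i t.
Hypothesis dA : forall i t, is_derive t (1 : R) (A i) (a i t).
Hypothesis df : forall i x, partial_derivable i f x.
Hypothesis dq : forall i j x, partial_derivable j (q i) x.
Hypothesis q_sign : forall i j x, 0 <= (-1) ^+ b i j * partial j (q i) x.

Let partialE i x : partial i f x = q i x * a i (tnth x i).
Proof. by rewrite /q divfK// gt_eqF. Qed.

(** For distinct i and j the factor 1 / a_i does not depend on x_j, so the sign
    condition says that d_i f is monotone in x_j. *)
Lemma mixed_sign_partial : mixed_sign b f.
Proof.
move=> i j x s s' t t' ij ss' tt'.
set y := set_coord j x t; set y' := set_coord j x t'.
have dh u : is_derive u (1 : R)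
    ((-1) ^+ b i j \*: ((fun s => f (set_coord i y' s))
      \- (fun s => f (set_coord i y s))))
    ((-1) ^+ b i j * (partial i f (set_coord i y' u) - partial i f (set_coord i y u))).
  by apply: is_deriveZ; apply: is_deriveB; exact: is_derive_partial.
have := is_derive_le dh ss' => le_ss'.
rewrite /increment -/y -/y'.
suff : (-1) ^+ b i j * (f (set_coord i y' s) - f (set_coord i y s)) <=
       (-1) ^+ b i j * (f (set_coord i y' s') - f (set_coord i y s')).
  by rewrite -subr_ge0 -mulrBr; congr (0 <= _ * _); ring.
apply: le_ss' => u _; rewrite !partialE !tnth_set_coord eqxx -mulrBl mulrA.
apply: mulr_ge0; last exact: ltW.
rewrite mulrBr subr_ge0 /y /y' !(set_coordC _ _ _ ij).
by apply: partial_ge0_le tt' => //; exact: dq.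
Qed.

Lemma convex_sign_partial : convex_sign A b f.
Proof.
move=> i x s t r st tr.
have -> : (-1) ^+ b i i * convexity_det (A i) (fun t => f (set_coord i x t)) s t r
    = convexity_det (A i) ((-1) ^+ b i i \*: (fun t => f (set_coord i x t))) s t r.
  by rewrite /convexity_det /= -![_ *: _]/(_ * _); ring.
pose e := (-1) ^+ b i i : R.
have dphi u : is_derive u (1 : R) (e \*: (fun t => f (set_coord i x t)))
    (e * q i (set_coord i x u) * a i u).
  have -> : e * q i (set_coord i x u) * a i u = e * partial i f (set_coord i x u).
    by rewrite partialE tnth_set_coord eqxx mulrA.
  by apply: is_deriveZ; exact: is_derive_partial.
apply: (convexity_det_ge0 (dA i) (a_gt0 i) dphi _ st tr) => u v uv.
by apply: partial_ge0_le uv; [exact: dq|exact: q_sign].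
Qed.

End partial_to_differences.

(** * Conditioning on a cube *)

Section conditioning.
Context {d} {T : measurableType d} {R : realType}.
Variables (mu : probability T R) (D : set T) (mD : measurable D).

(** The conditional probability given D, provided that D has positive mass. *)
Definition conditioned : probability T R := mnormalize (mrestr mu mD) mu.

Hypothesis D0 : 0 < fine (mu D).

Lemma conditionedE U :
  conditioned U = ((fine (mu D))^-1%:E * mu (U `&` D))%E.
Proof.
have muD : mu (setT `&` D) = (fine (mu D))%:E.
  by rewrite setTI fineK// fin_num_measure.
rewrite -[LHS]/((if (mu (setT `&` D) == 0%E) || (mu (setT `&` D) == +oo%E)
  then fun V => mu V
  else fun V => mu (V `&` D) * (fine (mu (setT `&` D)))^-1%:E)%E U).
by rewrite muD eqe gt_eqF//= muleC.
Qed.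

Lemma mean_conditioned h : bounded_mfun h ->
  mean conditioned h = (fine (mu D))^-1 * \int[mu]_(x in D) h x.
Proof.
move=> bh; have mh : measurable_fun setT (EFin \o h).
  by apply/measurable_EFinP; case: bh.
have k0 : 0 <= (fine (mu D))^-1 by rewrite invr_ge0 ltW.
pose k := NngNum k0.
have intD : mu.-integrable D (EFin \o h).
  by apply: integrableS (bmf_integrable mu bh).
rewrite /mean /Rintegral (@negligible_integral _ _ _ _ _ (~` D))//; last 3 first.
- exact: measurableC.
- exact: bmf_integrable.
- by rewrite [LHS]conditionedE setICl measure0 mule0.
rewrite setTD setCK (eq_measure_integral (mscale k mu)); last first.
  by move=> A mA AD; rewrite [LHS]conditionedE /mscale/= (setIidl AD).
rewrite -[RHS]/(fine k%:num%:E * _) -fineM//; last exact: integrable_fin_num.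
congr fine; rewrite integralE [in RHS]integralE.
rewrite !ge0_integral_mscale//; last 2 first.
- by apply: measurable_funeneg; exact: measurable_funTS.
- by apply: measurable_funepos; exact: measurable_funTS.
apply/esym/muleBr => //; apply: fin_num_adde_defr.
exact: integrable_pos_fin_num intD.
Qed.

End conditioning.

Section product_conditioned.
Context {R : realType}.
Local Notation RR := (measurableTypeR R).

Definition box n (D : 'I_n -> set RR) : set (n.-tuple RR) :=
  [set x | forall i, D i (tnth x i)].

Lemma measurable_box n (D : 'I_n -> set RR) :
  (forall i, measurable (D i)) -> measurable (box D).
Proof.
move=> mD; rewrite (_ : box D =
    \big[setI/setT]_(i < n) ((fun x => tnth x i) @^-1` D i)).
  apply: bigsetI_measurable => i _; rewrite -[X in measurable X]setTI.
  exact: measurable_tnth.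
rewrite -bigcap_seq; apply/seteqP; split=> x /= Bx i; first by move=> _.
by apply: Bx; rewrite /= mem_index_enum.
Qed.

Lemma product_probability_tnth n (P : 'I_n -> probability RR R) i B :
  measurable B -> product_probability P ((fun x => tnth x i) @^-1` B) = P i B.
Proof.
move=> mB; rewrite (_ : _ @^-1` B = box (fun j => if j == i then B else setT)).
  rewrite product_probability_box; last by move=> j; case: ifP.
  rewrite (bigD1 i)//= eqxx big1 ?mule1// => j /negbTE ->.
  by rewrite [LHS]probability_setT.
apply/seteqP; split=> x /=; last by move=> /(_ i); rewrite eqxx.
by move=> Bx j; case: eqP => // ->.
Qed.

(** Both sides agree on rectangles, which characterizes the product measure with
    the first factor split off. *)
Lemma product_conditioned n (P : 'I_n -> probability RR R) D
    (mD : forall i, measurable (D i)) (mB : measurable (box D)) :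
    0 < fine (product_probability P (box D)) ->
  forall U, measurable U ->
  product_probability (fun i => conditioned (P i) (mD i)) U =
  conditioned (product_probability P) mB U.
Proof.
elim: n P D mD mB => [|n IH] P D mD mB B0 U mU.
  have B1 : box D = setT by apply/seteqP; split=> // x _ [].
  have -> : mB = measurable_box mD by exact: Prop_irrelevance.
  rewrite conditionedE// -[product_probability P]/(dirac [tuple] : probability _ R).
  by rewrite B1 setIT [in X in X^-1]probability_setT invr1 mul1e.
pose D' i := D (lift ord0 i); pose mD' i : measurable (D' i) := mD (lift ord0 i).
have mB' := measurable_box mD'.
pose mu' := product_probability (ptail P).
have consB : @tuple_cons R n @^-1` box D = D ord0 `*` box D'.
  apply/seteqP; split=> -[t x] /=.
    by move=> Bx; split; [exact: (Bx ord0)|move=> i;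
      have := Bx (lift ord0 i); rewrite tnth_consS].
  move=> [Dt Bx] i; case: (unliftP ord0 i) => [j ->|->//].
  by rewrite tnth_consS; exact: Bx.
pose nu : probability (RR * n.-tuple RR)%type R := (P ord0 \x mu')%E.
have prodE A B : measurable A -> measurable B ->
    fine (nu (A `*` B)) = fine (P ord0 A) * fine (mu' B).
  by move=> mA mB0; rewrite [X in fine X]product_measure1E// fineM// fin_num_measure.
have imageE V : product_probability P V = nu (@tuple_cons R n @^-1` V) by [].
have nu0 : 0 < fine (nu (D ord0 `*` box D')) by rewrite -consB -imageE.
have BE : fine (product_probability P (box D)) =
    fine (P ord0 (D ord0)) * fine (mu' (box D')).
  by rewrite -prodE// -consB.
have D00 : 0 < fine (P ord0 (D ord0)).
  rewrite lt_neqAle fine_ge0// andbT eq_sym; apply/eqP => P0.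
  by move: B0; rewrite BE P0 mul0r ltxx.
have B'0 : 0 < fine (mu' (box D')).
  by move: B0; rewrite BE pmulr_rgt0.
have mV : measurable (@tuple_cons R n @^-1` U).
  by rewrite -[X in measurable X]setTI; exact: measurable_tuple_cons.
have mDB : measurable (D ord0 `*` box D') by exact: measurableX.
transitivity (conditioned nu mDB (@tuple_cons R n @^-1` U)).
  apply: product_measure_unique => // A B mA mBB.
  have IHB := IH (ptail P) D' mD' mB' B'0 B mBB.
  transitivity (conditioned (P ord0) (mD ord0) A * conditioned mu' mB' B)%E;
    last by rewrite -IHB.
  rewrite [LHS]conditionedE// [X in _ = (X * _)%E]conditionedE//.
  rewrite [X in _ = (_ * X)%E]conditionedE// -setXI.
  rewrite [X in (_ * X)%E = _]product_measure1E//; [|exact: measurableI..].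
  by rewrite prodE// invfM EFinM muleACA.
by rewrite [LHS]conditionedE// [RHS]conditionedE// !imageE preimage_setI consB.
Qed.

End product_conditioned.

(** * Convergence along an exhaustion *)

Section limits.
Context {d} {T : measurableType d} {R : realType}.
Variables (mu : probability T R) (D : nat -> set T).
Hypothesis mD : forall N, measurable (D N).
Hypothesis D_exhaust : forall x, \forall N \near \oo, D N x.

Lemma cvg_Rintegral_exhaust h : mu.-integrable setT (EFin \o h) ->
  \int[mu]_(x in D N) h x @[N --> \oo] --> mean mu h.
Proof.
move=> ih; have mh := measurable_int mu ih.
have ifin : (\int[mu]_x (h x)%:E)%E \is a fin_num.
  exact: integrable_fin_num.
have := @dominated_convergence _ _ _ mu setT measurableT
  (fun N => EFin \o (h \_ (D N))) (EFin \o h) (abse \o (EFin \o h)).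
case.
- move=> N; rewrite -restrict_EFin.
  by apply/(measurable_restrictT _ _).1 => //; exact: measurable_funTS.
- exact: mh.
- apply: aeW => x _; apply: cvg_near_cst.
  by near=> N; rewrite /= patchE mem_set//; near: N; exact: D_exhaust.
- exact: integrable_abse.
- apply: aeW => x N _; rewrite /= patchE; case: ifP => // _.
  by rewrite /= normr0 lee_fin normr_ge0.
move=> _ _; rewrite -[X in _ --> X]fineK// => /fine_cvg; apply: cvg_trans.
by apply: near_eq_cvg; near=> N; rewrite Rintegral_mkcond.
Unshelve. all: end_near. Qed.

Lemma cvg_mass_exhaust : fine (mu (D N)) @[N --> \oo] --> (1 : R).
Proof.
have /cvg_Rintegral_exhaust : mu.-integrable setT (EFin \o (fun=> 1)).
  exact: (bmf_integrable mu (bmf_cst 1)).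
rewrite mean_cst; under eq_fun do rewrite Rintegral_cst// mul1r.
exact.
Qed.

Lemma mass_exhaust_gt0 : \forall N \near \oo, 0 < fine (mu (D N)).
Proof. by have := cvgr_gt 1 cvg_mass_exhaust; apply. Qed.

(** The approximations h_ N need to agree with h only on D N, where the
    conditioned measure lives. *)
Lemma cvg_mean_conditioned h (h_ : nat -> T -> R) :
    mu.-integrable setT (EFin \o h) -> (forall N, bounded_mfun (h_ N)) ->
    (forall N x, D N x -> h_ N x = h x) ->
  mean (conditioned mu (mD N)) (h_ N) @[N --> \oo] --> mean mu h.
Proof.
move=> ih bh_ h_E.
have : (fine (mu (D N)))^-1 * \int[mu]_(x in D N) h x @[N --> \oo]
    --> 1^-1 * mean mu h.
  apply: cvgM; last exact: cvg_Rintegral_exhaust.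
  by apply: cvgV; [exact: oner_neq0|exact: cvg_mass_exhaust].
rewrite invr1 mul1r; apply: cvg_trans; apply: near_eq_cvg.
near=> N; rewrite mean_conditioned//; last by near: N; exact: mass_exhaust_gt0.
congr (_ * _); apply: eq_Rintegral => x; rewrite inE => /h_E //.
Unshelve. all: end_near. Qed.

Lemma cvg_rcov_conditioned X Y (X_ Y_ : nat -> T -> R) :
    mu.-integrable setT (EFin \o X) -> mu.-integrable setT (EFin \o Y) ->
    mu.-integrable setT (EFin \o (X \* Y)) ->
    (forall N, bounded_mfun (X_ N)) -> (forall N, bounded_mfun (Y_ N)) ->
    (forall N x, D N x -> X_ N x = X x) -> (forall N x, D N x -> Y_ N x = Y x) ->
  rcov (conditioned mu (mD N)) (X_ N) (Y_ N) @[N --> \oo] --> rcov mu X Y.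
Proof.
move=> iX iY iXY bX bY XE YE; apply: cvgB.
  apply: cvg_mean_conditioned => //; first by move=> N; exact: bmfM.
  by move=> N x DNx; rewrite /= XE ?YE.
by apply: cvgM; exact: cvg_mean_conditioned.
Qed.

Lemma covariance_rcov X Y :
    mu.-integrable setT (EFin \o X) -> mu.-integrable setT (EFin \o Y) ->
    mu.-integrable setT (EFin \o (X \* Y)) ->
  covariance mu X Y = (rcov mu X Y)%:E.
Proof.
move=> iX iY iXY.
have EE Z : mu.-integrable setT (EFin \o Z) -> ('E_mu[Z] = (mean mu Z)%:E)%E.
  by move=> iZ; rewrite unlock fineK//; exact: integrable_fin_num.
rewrite covarianceE ?EE//; exact/Lfun1_integrable.
Qed.

(** Stated with squares because the integrability of A_i (x_i) ^+ 2 follows from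
    that of A_i ^+ 2 for the marginal by a change of variables. *)
Lemma integrable_mul_sqr (X Y : T -> R) :
    measurable_fun setT X -> measurable_fun setT Y ->
    mu.-integrable setT (EFin \o (fun x => X x ^+ 2)) ->
    mu.-integrable setT (EFin \o (fun x => Y x ^+ 2)) ->
  mu.-integrable setT (EFin \o (X \* Y)).
Proof.
move=> mX mY iX iY.
apply: (le_integrable measurableT _ _ (integrableD measurableT iX iY)).
  by apply/measurable_EFinP; exact: measurable_funM.
move=> x _; rewrite /= lee_fin (ger0_norm (addr_ge0 _ _)) ?sqr_ge0//.
rewrite normrM -(real_normK (num_real (X x))) -(real_normK (num_real (Y x))).
by have := sqr_ge0 (`|X x| - `|Y x|); nra.
Qed.

Lemma integrable_of_sqr (X : T -> R) : measurable_fun setT X ->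
    mu.-integrable setT (EFin \o (fun x => X x ^+ 2)) ->
  mu.-integrable setT (EFin \o X).
Proof.
move=> mX iX; have i1 : mu.-integrable setT (EFin \o (fun=> 1 ^+ 2)).
  exact: (bmf_integrable mu (bmf_cst _)).
have := integrable_mul_sqr mX (measurable_cst (1 : R)) iX i1.
by rewrite (_ : X \* _ = X)//; apply/funext => x /=; rewrite mulr1.
Qed.

End limits.

Lemma integrable_tnth (R : realType) n
    (P : 'I_n -> probability (measurableTypeR R) R) i (h : measurableTypeR R -> R) :
  (P i).-integrable setT (EFin \o h) ->
  (product_probability P).-integrable setT (EFin \o (fun x => h (tnth x i))).
Proof.
move=> /integrableP[mh ih]; apply/integrableP; split.
  exact: (measurableT_comp mh (measurable_tnth i)).
pose proj (x : n.-tuple (measurableTypeR R)) : measurableTypeR R := tnth x i.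
pose phi : {mfun n.-tuple (measurableTypeR R) >-> measurableTypeR R} :=
  HB.pack proj (isMeasurableFun.Build _ _ _ _ proj (measurable_tnth i)).
apply: le_lt_trans ih.
rewrite [leRHS](eq_measure_integral (distribution (product_probability P) phi)).
  by rewrite ge0_integral_distribution//; exact: measurableT_comp.
by move=> B mB _; exact/esym/product_probability_tnth.
Qed.

(** * The covariance inequality *)

Lemma cvg_sum_ord (R : realType) n (u : 'I_n -> nat -> R) (l : 'I_n -> R) :
    (forall i, u i N @[N --> \oo] --> l i) ->
  \sum_(i < n) u i N @[N --> \oo] --> \sum_(i < n) l i.
Proof. by move=> ul; apply: cvg_big => //; exact: add_continuous. Qed.

Lemma same_constant_sign_bool (T : Type) (R : realType) (u v : T -> R) :
  same_constant_sign u v ->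
  exists b : bool, forall x, 0 <= (-1) ^+ b * u x /\ 0 <= (-1) ^+ b * v x.
Proof.
case=> uv; [exists false|exists true] => x; have [u0 v0] := uv x.
  by rewrite expr0 !mul1r.
by rewrite expr1 !mulN1r !oppr_ge0.
Qed.

Section exhaustion.
Context {R : realType}.
Local Notation RR := (measurableTypeR R).

Definition segment (N : nat) : set RR := `[- N%:R, N%:R]%classic.

Lemma measurable_segment N : measurable (segment N).
Proof. exact: measurable_itv. Qed.

Lemma segment_exhaust (t : RR) : \forall N \near \oo, segment N t.
Proof.
near=> N; rewrite /segment /= in_itv/= -ler_norml.
by near: N; exact: nbhs_infty_ger.
Unshelve. all: end_near. Qed.

Lemma box_segment_exhaust n (x : n.-tuple RR) :
  \forall N \near \oo, box (fun _ : 'I_n => segment N) x.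
Proof. by apply: filter_forall => i; exact: segment_exhaust. Qed.

Lemma clamp_tuple_id n N (x : n.-tuple R) :
  box (fun _ : 'I_n => segment N) x -> clamp_tuple N%:R x = x.
Proof.
by move=> Bx; apply: eq_from_tnth => i; rewrite tnth_mktuple clamp_id//; exact: Bx.
Qed.

End exhaustion.

Theorem theorem1p4 (R : realType) (d : nat)
    (P : 'I_d -> probability (measurableTypeR R) R)
    (a A : 'I_d -> R -> R) (f g : d.-tuple R -> R)
    (mu := product_probability P)
    (a_gt0 : forall k t, 0 < a k t)
    (A_primitive : forall k (t : R), is_derive t (1 : R) (A k) (a k t))
    (A_L2 : forall k, (A k : measurableTypeR R -> R) \in Lfun (P k) 2%:E)
    (A_centered : forall k, ('E_(P k)[A k] = 0)%E)
    (VarA_gt0 : forall k, (0 < 'V_(P k)[A k])%E)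
    (f_L2 : (f : d.-tuple (measurableTypeR R) -> R) \in Lfun mu 2%:E)
    (g_L2 : (g : d.-tuple (measurableTypeR R) -> R) \in Lfun mu 2%:E)
    (f_deriv1 : forall i x, partial_derivable i f x)
    (g_deriv1 : forall i x, partial_derivable i g x)
    (f_deriv2 : forall i j x, partial_derivable j (partial i f) x)
    (g_deriv2 : forall i j x, partial_derivable j (partial i g) x)
    (f_quot_deriv : forall i j x,
      partial_derivable j (fun y => partial i f y / a i (tnth y i)) x)
    (g_quot_deriv : forall i j x,
      partial_derivable j (fun y => partial i g y / a i (tnth y i)) x)
    (f_int1 : forall i, mu.-integrable setT (EFin \o partial i f))
    (g_int1 : forall i, mu.-integrable setT (EFin \o partial i g))
    (f_int2 : forall i j,
      mu.-integrable setT (EFin \o partial j (partial i f)))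
    (g_int2 : forall i j,
      mu.-integrable setT (EFin \o partial j (partial i g)))
    (same_sign : forall i j, same_constant_sign
      (partial j (fun x => partial i f x / a i (tnth x i)))
      (partial j (fun x => partial i g x / a i (tnth x i)))) :
  (\sum_(i < d) ('V_(P i)[A i])^-1
      * covariance mu f (fun x => A i (tnth x i))
      * covariance mu g (fun x => A i (tnth x i))
    <= covariance mu f g)%E.
Proof.
have [b bP] : exists b : 'I_d -> 'I_d -> bool, forall i j x,
    0 <= (-1) ^+ b i j * partial j (fun y => partial i f y / a i (tnth y i)) x /\
    0 <= (-1) ^+ b i j * partial j (fun y => partial i g y / a i (tnth y i)) x.
  have /choice[b bP] (ij : 'I_d * 'I_d) := same_constant_sign_bool
    (same_sign ij.1 ij.2).
  by exists (fun i j => b (i, j)) => i j; exact: bP (i, j).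
have mixf : mixed_sign b f.
  by apply: (mixed_sign_partial a_gt0 f_deriv1 f_quot_deriv) => i j x; case: (bP i j x).
have mixg : mixed_sign b g.
  by apply: (mixed_sign_partial a_gt0 g_deriv1 g_quot_deriv) => i j x; case: (bP i j x).
have convf : convex_sign A b f.
  by apply: (convex_sign_partial a_gt0 A_primitive f_deriv1 f_quot_deriv) => i j x;
    case: (bP i j x).
have convg : convex_sign A b g.
  by apply: (convex_sign_partial a_gt0 A_primitive g_deriv1 g_quot_deriv) => i j x;
    case: (bP i j x).
have A_homo i s t : s <= t -> A i s <= A i t.
  by move=> st; apply: (is_derive_le (A_primitive i)) => // ? _; exact: ltW.
have mA i : measurable_fun setT (A i : measurableTypeR R -> R).
  by have := A_L2 i; rewrite inE => /andP[+ _]; rewrite inE.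
have mf : measurable_fun setT (f : d.-tuple (measurableTypeR R) -> R).
  by have := f_L2; rewrite inE => /andP[+ _]; rewrite inE.
have mg : measurable_fun setT (g : d.-tuple (measurableTypeR R) -> R).
  by have := g_L2; rewrite inE => /andP[+ _]; rewrite inE.
pose At i (x : d.-tuple (measurableTypeR R)) := A i (tnth x i).
have mAt i : measurable_fun setT (At i).
  exact: (measurableT_comp (mA i) (measurable_tnth i)).
have f2 := Lfun2_integrable_sqr f_L2; have g2 := Lfun2_integrable_sqr g_L2.
have A2 i := Lfun2_integrable_sqr (A_L2 i).
have At2 i : mu.-integrable setT (EFin \o (fun x => At i x ^+ 2)).
  exact: (integrable_tnth (A2 i)).
have if1 := integrable_of_sqr mf f2; have ig1 := integrable_of_sqr mg g2.
have iA1 i := integrable_of_sqr (mA i) (A2 i).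
have iAt1 i := integrable_of_sqr (mAt i) (At2 i).
have ifg := integrable_mul_sqr mf mg f2 g2.
have ifA i := integrable_mul_sqr mf (mAt i) f2 (At2 i).
have igA i := integrable_mul_sqr mg (mAt i) g2 (At2 i).
have iAA i := integrable_mul_sqr (mA i) (mA i) (A2 i) (A2 i).
have varE i : 'V_(P i)[A i] = (rcov (P i) (A i) (A i))%:E.
  exact: covariance_rcov.
have V0 i : 0 < rcov (P i) (A i) (A i) by rewrite -lte_fin -varE.
rewrite covariance_rcov//.
under eq_bigr => i _.
  rewrite varE inver gt_eqF// (covariance_rcov (Y := At i))//.
  rewrite (covariance_rcov (Y := At i))// -!EFinM; over.
rewrite sumEFin lee_fin.
(* Clamping makes the functions bounded without changing them on the cube B N,
   which carries the conditioned measures. *)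
pose B N := box (fun _ : 'I_d => @segment R N).
have mB N : measurable (B N) by apply: measurable_box => _; exact: measurable_segment.
pose muN N := conditioned mu (mB N).
pose Q N i := conditioned (P i) (@measurable_segment R N).
pose fN N := f \o @clamp_tuple R N%:R d.
pose gN N := g \o @clamp_tuple R N%:R d.
pose AN N i := A i \o clamp N%:R.
pose AtN N i (x : d.-tuple (measurableTypeR R)) := AN N i (tnth x i).
have bmf_clamp N h : (forall i x, partial_derivable i h x) ->
    measurable_fun setT (h : d.-tuple (measurableTypeR R) -> R) ->
    mixed_sign b h ->
    bounded_mfun (h \o @clamp_tuple R N%:R d : d.-tuple (measurableTypeR R) -> R).
  move=> dh mh mixh; split.
    by apply: measurableT_comp => //; exact: measurable_clamp_tuple.
  apply: (mixed_sign_clamp_bounded (ler0n R N) mixh) => i x.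
  exact: (is_derive_continuous (is_derive_partial (dh i) x)).
have bfN N : bounded_mfun (fN N) by exact: bmf_clamp.
have bgN N : bounded_mfun (gN N) by exact: bmf_clamp.
have bAN N i : bounded_mfun (AN N i : measurableTypeR R -> R).
  split; first exact: (measurableT_comp (mA i) (measurable_clamp _)).
  exists (`|A i (- N%:R)| + `|A i N%:R|) => t.
  have /= /andP[Nt tN] := clamp_itv (ler0n R N) t.
  have := A_homo i _ _ Nt; have := A_homo i _ _ tN.
  have := ler_norm (- A i (- N%:R)); have := ler_norm (A i N%:R).
  have := normr_ge0 (A i N%:R); have := normr_ge0 (A i (- N%:R)).
  rewrite normrN /AN /= => *; rewrite ler_norml; apply/andP; split; lra.
have bAtN N i : bounded_mfun (AtN N i) by exact: (bmf_comp (measurable_tnth i) (bAN N i)).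
have fNE N x : B N x -> fN N x = f x by move=> /clamp_tuple_id; rewrite /fN /= => ->.
have gNE N x : B N x -> gN N x = g x by move=> /clamp_tuple_id; rewrite /gN /= => ->.
have ANE N i t : segment N t -> AN N i t = A i t.
  by move=> tN; rewrite /AN /= clamp_id.
have AtNE N i x : B N x -> AtN N i x = At i x by move=> Bx; exact: ANE.
have B_exhaust x : \forall N \near \oo, B N x by exact: box_segment_exhaust.
have cvg_var i : rcov (Q N i) (AN N i) (AN N i) @[N --> \oo] --> rcov (P i) (A i) (A i).
  apply: (@cvg_rcov_conditioned _ _ _ (P i) _ (@measurable_segment R)
    segment_exhaust _ _ (AN ^~ i) (AN ^~ i)) => // N x; exact: ANE.
have cvgfg : rcov (muN N) (fN N) (gN N) @[N --> \oo] --> rcov mu f g.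
  exact: cvg_rcov_conditioned.
have cvgfA i : rcov (muN N) (fN N) (AtN N i) @[N --> \oo] --> rcov mu f (At i).
  by apply: cvg_rcov_conditioned => // N x; exact: AtNE.
have cvggA i : rcov (muN N) (gN N) (AtN N i) @[N --> \oo] --> rcov mu g (At i).
  by apply: cvg_rcov_conditioned => // N x; exact: AtNE.
have cvg_lhs : \sum_(i < d) (rcov (Q N i) (AN N i) (AN N i))^-1 *
      rcov (muN N) (fN N) (AtN N i) * rcov (muN N) (gN N) (AtN N i) @[N --> \oo]
    --> \sum_(i < d) (rcov (P i) (A i) (A i))^-1 *
      rcov mu f (At i) * rcov mu g (At i).
  apply: (cvg_sum_ord (u := fun i N => (rcov (Q N i) (AN N i) (AN N i))^-1 *
      rcov (muN N) (fN N) (AtN N i) * rcov (muN N) (gN N) (AtN N i))) => i.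
  apply: cvgM => //; apply: cvgM => //.
  by apply: cvgV => //; rewrite gt_eqF.
apply: (ler_cvg_to cvg_lhs cvgfg).
near=> N.
have B0 : 0 < fine (mu (B N)) by near: N; exact: mass_exhaust_gt0.
have VN0 i : 0 < rcov (Q N i) (AN N i) (AN N i).
  move: i; near: N; apply: filter_forall => i.
  by have := cvgr_gt _ (cvg_var i) _ (V0 i); apply.
have rcovQ X Y : rcov (muN N) X Y = rcov (product_probability (Q N)) X Y.
  have meanQ h : mean (product_probability (Q N)) h = mean (muN N) h.
    congr fine; apply: eq_measure_integral => U mU _.
    exact: product_conditioned.
  by rewrite /rcov !meanQ.
have AN_homo i s t : s <= t -> AN N i s <= AN N i t.
  by move=> st; apply: A_homo; exact: clamp_homo.
rewrite rcovQ; under eq_bigr do rewrite !rcovQ -mulrA mulrC.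
exact: (bounded_covariance_bound (bAN N) AN_homo VN0 (bfN N) (bgN N)
  (mixed_sign_clamp _ mixf) (mixed_sign_clamp _ mixg)
  (convex_sign_clamp _ convf) (convex_sign_clamp _ convg)).
Unshelve. all: end_near. Qed.
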